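(* Let $G=\langle X\mid R(X)\rangle$ and $H=\langle Y\mid S(Y)\rangle$ be presentations of groups $G$ and $H$. Let $T\subseteq G$ be a subset such that $T\cap T^{-1}=\emptyset$ and $T\cup T^{-1}=G\setminus\{1\}$, where $T^{-1}=\{t^{-1}\mid t\in T\}$. Then the wreath product $W=H\wr G$ has the presentation $$W=\langle X,Y\mid R(X),\ S(Y),\ [y,t^{-1}zt]=1\ \text{ for all } y,z\in Y,\ t\in T\rangle .$$ If, moreover, the given presentations of $G$ and $H$ are minimal and the set of generators $Y$ of $H$ is conormal, then this presentation of $W$ is minimal as well.
   Context: For groups $G,H$, let $H^G$ be the group (under pointwise multiplication) of all maps $f:G\to H$ with finite support, i.e. $f(x)=1$ for all but finitely many $x\in G$. The (restricted regular) wreath product is the semidirect product $H\wr G=H^G\rtimes G$ with respect to the action of $G$ on $H^G$ in which $g\in G$ sends $f$ to the map $a\mapsto f(ag)$. Writing $h(a)$ ($h\in H$, $a\in G$) for the map with value $h$ at $a$ and $1$ elsewhere, conjugation in $H\wr G$ is given by $g^{-1}h(a)g=h(ag)$. In the presentation of $W$, the elements of $X$ denote the corresponding elements of the subgroup $G\subseteq W$, and $y\in Y$ denotes the element $y(1)\in H^G\subseteq W$; in a relation, $t\in T$ stands for a word in $X$ representing $t$. $\langle X\mid R(X)\rangle$ denotes a presentation with set of generators $X$ and set of defining relations $R(X)$. A presentation is called minimal if none of its generators and none of its defining relations can be excluded (i.e. no proper subset of the set of generators generates the group, and no defining relation is a consequence of the other defining relations). A set of generators $X$ of a group is called conormal if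 no element $x\in X$ belongs to the normal subgroup $N_x$ generated (as a normal subgroup) by all elements of $X\setminus\{x\}$. *)

(* Defs.v *)
From HB Require Import structures.
From mathcomp Require Import all_boot finmap.
From mathcomp Require Import boolp classical_sets.

Set Implicit Arguments.
Unset Strict Implicit.
Unset Printing Implicit Defensive.

Local Open Scope group_scope.
Local Open Scope classical_set_scope.

(* MathComp style; groups are the (possibly infinite) groupType of monoid.v. *)

Section FreeGroup.
Variable X : choiceType.

(* The letter (x, false) stands for x and (x, true) for its inverse. *)
Definition letter : Type := (X * bool)%type.

Definition letter_inv (a : letter) : letter := (a.1, ~~ a.2).

Definition reduced (u : seq letter) : bool :=
  sorted (fun a b => b != letter_inv a) u.

Record freegroup : Type := FreeGroup {
  fg_word : seq letter;
  fg_reduced : reduced fg_word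
}.

HB.instance Definition _ := [isSub for fg_word].
HB.instance Definition _ := [Choice of freegroup by <:].

(* Left multiplication of a reduced word by a letter, with cancellation. *)
Definition push (a : letter) (u : seq letter) : seq letter :=
  if u is b :: u' then if b == letter_inv a then u' else a :: u else [:: a].

Definition reduced_mul (u v : seq letter) : seq letter := foldr push v u.

Definition reduced_inv (u : seq letter) : seq letter :=
  rev [seq letter_inv a | a <- u].

Lemma letter_invK : involutive letter_inv.
Proof. by case=> x b; rewrite /letter_inv /= negbK. Qed.

Lemma reduced_cons a u : reduced (a :: u) -> reduced u.
Proof. by case: u => //= b u /andP[]. Qed.

Lemma push_reduced a u : reduced u -> reduced (push a u).
Proof.
case: u => //= b u; case: eqVneq => [_|neq_ba] red_u; first exact: path_sorted red_u.
by rewrite /reduced /= neq_ba.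
Qed.

Lemma push_cons a u : reduced (a :: u) -> push a u = a :: u.
Proof. by case: u => //= b u /andP[/negPf->]. Qed.

Lemma pushK a u : reduced u -> push (letter_inv a) (push a u) = u.
Proof.
case: u => [|b u] red_u /=; first by rewrite letter_invK eqxx.
case: eqVneq => [eq_ba|_] /=; last by rewrite letter_invK eqxx.
by rewrite -eq_ba push_cons.
Qed.

Lemma pushVK a u : reduced u -> push a (push (letter_inv a) u) = u.
Proof. by move=> ?; rewrite -{1}[a]letter_invK pushK. Qed.

Lemma reduced_mul_reduced u v : reduced v -> reduced (reduced_mul u v).
Proof. by move=> red_v; elim: u => //= a u; apply: push_reduced. Qed.

Lemma reduced_mul_push a u v :
  reduced v -> reduced_mul (push a u) v = push a (reduced_mul u v).
Proof.
move=> red_v; case: u => //= b u; case: eqVneq => //= ->.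
by rewrite pushVK // reduced_mul_reduced.
Qed.

Lemma reduced_mulA u v w : reduced w ->
  reduced_mul u (reduced_mul v w) = reduced_mul (reduced_mul u v) w.
Proof. by move=> red_w; elim: u => //= a u ->; rewrite reduced_mul_push. Qed.

Lemma reduced_mul1 u : reduced u -> reduced_mul u [::] = u.
Proof.
elim: u => //= a u IHu red_au.
by rewrite IHu ?push_cons //; apply: reduced_cons red_au.
Qed.

Lemma reduced_invK : involutive reduced_inv.
Proof.
by move=> u; rewrite /reduced_inv map_rev revK -map_comp map_id_in // => a _;
   apply: letter_invK.
Qed.

Lemma reduced_inv_reduced u : reduced u -> reduced (reduced_inv u).
Proof.
rewrite /reduced /reduced_inv rev_sorted sorted_map.
apply: sub_sorted => a b; apply: contraNneq => /= ->.
by rewrite letter_invK.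
Qed.

Lemma reduced_mulV u : reduced_mul (reduced_inv u) u = [::].
Proof.
rewrite /reduced_mul /reduced_inv; elim: u => //= a u IHu.
by rewrite rev_cons foldr_rcons /= letter_invK eqxx.
Qed.

Definition fg_one : freegroup := FreeGroup (isT : reduced [::]).

Definition fg_mul (u v : freegroup) : freegroup :=
  FreeGroup (reduced_mul_reduced (fg_word u) (fg_reduced v)).

Definition fg_inv (u : freegroup) : freegroup :=
  FreeGroup (reduced_inv_reduced (fg_reduced u)).

Lemma fg_mulA : associative fg_mul.
Proof. by move=> u v w; apply/val_inj/reduced_mulA/fg_reduced. Qed.

Lemma fg_mul1g : left_id fg_one fg_mul.
Proof. by move=> u; apply/val_inj. Qed.

Lemma fg_mulg1 : right_id fg_one fg_mul.
Proof. by move=> u; apply/val_inj/reduced_mul1/fg_reduced. Qed.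

Lemma fg_mulVg : left_inverse fg_one fg_inv fg_mul.
Proof. by move=> u; apply/val_inj/reduced_mulV. Qed.

Lemma fg_mulgV : right_inverse fg_one fg_inv fg_mul.
Proof.
move=> u; apply/val_inj => /=.
by rewrite -{1}[fg_word u]reduced_invK reduced_mulV.
Qed.

HB.instance Definition _ :=
  isGroup.Build freegroup fg_mulA fg_mul1g fg_mulg1 fg_mulVg fg_mulgV.

Definition fg_gen (x : X) : freegroup :=
  FreeGroup (isT : reduced [:: (x, false)]).

Section Eval.
Variables (G : groupType) (phi : X -> G).

Definition letter_eval (a : letter) : G :=
  if a.2 then (phi a.1)^-1 else phi a.1.

(* The homomorphism from the free group on X to G extending phi. *)
Definition fg_eval (u : freegroup) : G :=
  \prod_(a <- fg_word u) letter_eval a.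

Lemma fg_eval_gen x : fg_eval (fg_gen x) = phi x.
Proof. by rewrite /fg_eval /= big_seq1. Qed.

Lemma letter_evalV a : letter_eval (letter_inv a) = (letter_eval a)^-1.
Proof. by case: a => x [] //=; rewrite /letter_eval /= invgK. Qed.

Lemma push_eval a u :
  \prod_(b <- push a u) letter_eval b =
  letter_eval a * \prod_(b <- u) letter_eval b.
Proof.
case: u => [|b u] /=; first by rewrite big_seq1 big_nil mulg1.
case: eqVneq => [->|_]; last by rewrite big_cons.
by rewrite big_cons letter_evalV mulVKg.
Qed.

Fact fg_evalM : monoid_morphism fg_eval.
Proof.
split=> [|u v]; first by rewrite /fg_eval big_nil.
rewrite /fg_eval /= /reduced_mul.
elim: (fg_word u) => [|a s IHs] /=; first by rewrite big_nil mul1g.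
by rewrite push_eval IHs big_cons mulgA.
Qed.

HB.instance Definition _ := isUMagmaMorphism.Build freegroup G fg_eval fg_evalM.

End Eval.
End FreeGroup.

Definition fg_map (X Y : choiceType) (f : X -> Y) : freegroup X -> freegroup Y :=
  fg_eval (fun x => fg_gen (f x)).

Section Presentations.
Implicit Types G : groupType.

Definition is_subgroup G (K : set G) : Prop :=
  K 1 /\ (forall a b, K a -> K b -> K (a / b)).

Definition is_normal_subgroup G (K : set G) : Prop :=
  is_subgroup K /\ (forall a g, K a -> K (a ^ g)).

Definition subgroup_gen G (A : set G) : set G := smallest (@is_subgroup G) A.

Definition normal_closure G (A : set G) : set G :=
  smallest (@is_normal_subgroup G) A.

(* A relation u = v is encoded by the relator u v^-1. The alphabet X is        *)
(* abstract, gen x being the element of G denoted by x; below, sets of         *)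
(* generators are subsets of the alphabet.                                     *)
Definition presentation G (X : choiceType) (gen : X -> G)
    (R : set (freegroup X)) : Prop :=
  subgroup_gen (range gen) = setT /\
  [set u | fg_eval gen u = 1] = normal_closure R.

Definition minimal_presentation G (X : choiceType) (gen : X -> G)
    (R : set (freegroup X)) : Prop :=
  [/\ presentation gen R,
      forall A : set X, A `<` setT -> subgroup_gen (gen @` A) <> setT
    & forall r, R r -> ~ normal_closure (R `\ r) r].

Definition conormal G (X : choiceType) (gen : X -> G) : Prop :=
  forall x, ~ normal_closure (gen @` [set~ x]) (gen x).

End Presentations.

Section Base.
Variables H G : groupType.

Definition wr_base : Type := {fsfun G -> H with 1}.
HB.instance Definition _ := Choice.on wr_base.
Implicit Types f g : wr_base.

Definition base_fun f : G -> H := fun_of_fsfun f.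
Coercion base_fun : wr_base >-> Funclass.

Definition base_one : wr_base := [fsfun].
Definition base_mul f g : wr_base :=
  [fsfun a in (finsupp f `|` finsupp g)%fset => f a * g a].
Definition base_inv f : wr_base := [fsfun a in finsupp f => (f a)^-1].

(* The support of a |-> f (a * c) is the right translate by c^-1 of that of f. *)
Definition base_act (c : G) f : wr_base :=
  [fsfun a in [fset b / c | b in finsupp f]%fset => f (a * c)].

(* The element h(a), with value h at a and 1 elsewhere. *)
Definition base_single (h : H) (a : G) : wr_base :=
  [fsfun base_one with a |-> h].

Lemma base_eqP f g : f =1 g <-> f = g.
Proof. exact: fsfunP. Qed.

Lemma base_out f a : a \notin finsupp f -> f a = 1.
Proof. exact: fsfun_dflt. Qed.

Lemma base_oneE a : base_one a = 1.
Proof. exact: fsfun0E. Qed.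

Lemma base_mulE f g a : base_mul f g a = f a * g a.
Proof.
rewrite {1}/base_fun /base_mul fsfunE in_fsetU.
by case: ifPn => //; rewrite negb_or => /andP[/base_out-> /base_out->]; rewrite mulg1.
Qed.

Lemma base_invE f a : base_inv f a = (f a)^-1.
Proof.
rewrite {1}/base_fun /base_inv fsfunE.
by case: ifPn => // /base_out->; rewrite invg1.
Qed.

Lemma base_actE c f a : base_act c f a = f (a * c).
Proof.
rewrite {1}/base_fun /base_act fsfunE; case: ifPn => // a_out.
rewrite base_out //; apply: contra a_out => ac_in.
by apply/imfsetP; exists (a * c); rewrite ?mulgK.
Qed.

Lemma base_singleE h a b : base_single h a b = if b == a then h else 1.
Proof. by rewrite {1}/base_fun fsfun_withE fsfun0E. Qed.

Lemma base_mulA : associative base_mul.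
Proof. by move=> f g h; apply/base_eqP => a; rewrite !base_mulE mulgA. Qed.

Lemma base_mul1g : left_id base_one base_mul.
Proof. by move=> f; apply/base_eqP => a; rewrite base_mulE base_oneE mul1g. Qed.

Lemma base_mulg1 : right_id base_one base_mul.
Proof. by move=> f; apply/base_eqP => a; rewrite base_mulE base_oneE mulg1. Qed.

Lemma base_mulVg : left_inverse base_one base_inv base_mul.
Proof.
by move=> f; apply/base_eqP => a; rewrite base_mulE base_invE base_oneE mulVg.
Qed.

Lemma base_mulgV : right_inverse base_one base_inv base_mul.
Proof.
by move=> f; apply/base_eqP => a; rewrite base_mulE base_invE base_oneE mulgV.
Qed.

HB.instance Definition _ :=
  isGroup.Build wr_base base_mulA base_mul1g base_mulg1 base_mulVg base_mulgV.

Lemma base_act1 f : base_act 1 f = f.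
Proof. by apply/base_eqP => a; rewrite base_actE mulg1. Qed.

Lemma base_actA c d f : base_act c (base_act d f) = base_act (c * d) f.
Proof. by apply/base_eqP => a; rewrite !base_actE mulgA. Qed.

Lemma base_actM c f g : base_act c (f * g) = base_act c f * base_act c g.
Proof. by apply/base_eqP => a; rewrite !(base_mulE, base_actE). Qed.

Lemma base_act_one c : base_act c 1 = 1.
Proof. by apply/base_eqP => a; rewrite base_actE !base_oneE. Qed.

End Base.

Section Wreath.
Variables H G : groupType.

(* The semidirect product of H^G and G for base_act; Wreath f c stands for     *)
(* the product f c with f in H^G and c in G. A record, since the product type  *)
(* already carries the direct product group structure.                         *)
Record wreath : Type := Wreath { wr_fst : wr_base H G; wr_snd : G }.
Implicit Types u v w : wreath.

Definition wr_pair u : wr_base H G * G := (wr_fst u, wr_snd u).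
Definition wr_of_pair (p : wr_base H G * G) : wreath := Wreath p.1 p.2.

Lemma wr_pairK : cancel wr_pair wr_of_pair.
Proof. by case. Qed.

HB.instance Definition _ := Choice.copy wreath (can_type wr_pairK).

Definition wr_one : wreath := Wreath 1 1.
Definition wr_mul u v : wreath :=
  Wreath (wr_fst u * base_act (wr_snd u) (wr_fst v)) (wr_snd u * wr_snd v).
Definition wr_inv u : wreath :=
  Wreath (base_act (wr_snd u)^-1 (wr_fst u)^-1) (wr_snd u)^-1.

Lemma wr_mulA : associative wr_mul.
Proof.
by move=> [f a] [g b] [h c]; rewrite /wr_mul /= base_actM base_actA !mulgA.
Qed.

Lemma wr_mul1g : left_id wr_one wr_mul.
Proof. by move=> [f a]; rewrite /wr_mul /= base_act1 !mul1g. Qed.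

Lemma wr_mulg1 : right_id wr_one wr_mul.
Proof. by move=> [f a]; rewrite /wr_mul /= base_act_one !mulg1. Qed.

Lemma wr_mulVg : left_inverse wr_one wr_inv wr_mul.
Proof.
by move=> [f a]; rewrite /wr_mul /= -base_actM !mulVg base_act_one.
Qed.

Lemma wr_mulgV : right_inverse wr_one wr_inv wr_mul.
Proof.
by move=> [f a]; rewrite /wr_mul /= base_actA !mulgV base_act1 mulgV.
Qed.

HB.instance Definition _ :=
  isGroup.Build wreath wr_mulA wr_mul1g wr_mulg1 wr_mulVg wr_mulgV.

Definition wr_inbase (f : wr_base H G) : wreath := Wreath f 1.
Definition wr_intop (c : G) : wreath := Wreath 1 c.

Lemma wr_conj_single (h : H) (a g : G) :
  wr_inbase (base_single h a) ^ wr_intop g = wr_inbase (base_single h (a * g)).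
Proof.
congr Wreath; last by rewrite /= mul1g mulVg.
apply/base_eqP => b.
rewrite /= !(base_mulE, base_actE, base_oneE, base_singleE, base_invE).
by rewrite invg1 !mul1g mulg1 -(inj_eq (mulIg g)) mulgVK.
Qed.

End Wreath.

Definition wreath_gen (G H : groupType) (X Y : choiceType)
    (gX : X -> G) (gY : Y -> H) (s : X + Y) : wreath H G :=
  match s with
  | inl x => wr_intop H (gX x)
  | inr y => wr_inbase (base_single (gY y) (1 : G))
  end.

(* word t is meant to represent t when T t. *)
Definition wreath_rel (G : groupType) (X Y : choiceType)
    (R : set (freegroup X)) (S : set (freegroup Y))
    (T : set G) (word : G -> freegroup X) : set (freegroup (X + Y)%type) :=
  fg_map inl @` R `|` fg_map inr @` S `|`
  [set r | exists y z t, T t /\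
     r = [~ fg_gen (inr y), fg_gen (inr z) ^ fg_map inl (word t)]].

(* Main.v *)
Require Import Defs.
From HB Require Import structures.
From mathcomp Require Import all_boot.
From mathcomp Require Import boolp classical_sets.

(* In the group Q presented by the relators, the images of G and H are defined,
   and distinct G-conjugates of the image of H commute: one centralizes a
   generating set at a time, and T, T^-1 cover G minus 1. Pushing letters of G
   to the right writes each element of Q as a product of conjugates h^a followed
   by an element of G; if the corresponding element of W is trivial, the factors
   can be sorted by a and cancel.

   Minimality: a relator of G survives when Y is killed, and a relator s of H
   survives in (F(Y)/<<S \ s>>) wr G. For the relator [y0, z0^t0], conormality and
   a wreath product give maps lam, mu from H to a group P, where lam kills
   Y \ y0, mu kills Y \ z0, and lam y0, mu z0 do not commute. Send y in Y to the
   function with value lam y at 1 and mu y at t0^-1 in P wr G: since t0^-1 is not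
   in T, [y0, z0^t0] is the only commutator relator that fails. *)

Set Implicit Arguments.
Unset Strict Implicit.
Unset Printing Implicit Defensive.

Local Open Scope group_scope.
Local Open Scope classical_set_scope.

(* The library's mulgA rewrites to a multiplication with an unfolded structure,
   on which the cancellation lemmas no longer match. *)
Lemma group_mulA (G : groupType) : associative (fun a b : G => a * b).
Proof. exact: mulgA. Qed.

(** * Subgroups, generated subgroups and normal closures *)

Section Subgroups.
Variable G : groupType.
Implicit Types (K A : set G) (a b : G).

Lemma is_subgroupV K a : is_subgroup K -> K a -> K a^-1.
Proof. by move=> [K1 KF] Ka; rewrite -div1g; apply: KF. Qed.

Lemma is_subgroupM K a b : is_subgroup K -> K a -> K b -> K (a * b).
Proof.
by move=> sK Ka Kb; rewrite -[b]invgK; apply: sK.2 => //; apply: is_subgroupV.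
Qed.

Lemma is_subgroup_centralizer b : is_subgroup [set a | commute a b].
Proof.
split=> [|a c /= ab cb]; first exact/commute_sym/commute1.
apply/commute_sym/commuteM; first exact: commute_sym.
exact/commuteV/commute_sym.
Qed.

Lemma subgroup_gen_subgroup A : is_subgroup (subgroup_gen A).
Proof.
split=> [K [[]]//|a b Aa Ab K sKA].
by apply: sKA.1.2; [apply: Aa | apply: Ab].
Qed.

Lemma sub_subgroup_gen A : A `<=` subgroup_gen A.
Proof. exact: sub_gen_smallest. Qed.

Lemma normal_closure_normal A : is_normal_subgroup (normal_closure A).
Proof.
split=> [|a g Aa K sKA]; last by apply: sKA.1.2; apply: Aa.
split=> [K [[[]]]//|a b Aa Ab K sKA].
by apply: sKA.1.1.2; [apply: Aa | apply: Ab].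
Qed.

Lemma sub_normal_closure A : A `<=` normal_closure A.
Proof. exact: sub_gen_smallest. Qed.

End Subgroups.

(** * Preimages, ranges and kernels of morphisms *)

Section Preimages.
Variables (G H : groupType) (f : UMagmaMorphism.type G H).

Lemma is_subgroup_preimage (K : set H) : is_subgroup K -> is_subgroup (f @^-1` K).
Proof.
move=> [K1 KF]; split=> [|a b] /=; first by rewrite gmulf1.
by rewrite gmulfF; apply: KF.
Qed.

Lemma is_subgroup_range : is_subgroup (range f).
Proof.
split; first by exists 1; rewrite ?gmulf1.
by move=> _ _ [a _ <-] [b _ <-]; exists (a / b); rewrite ?gmulfF.
Qed.

Lemma kernel_normal : is_normal_subgroup [set a | f a = 1].
Proof.
split; last by move=> a g /= fa; rewrite gmulfJ fa conj1g.
split=> [|a b /= fa fb]; first exact: gmulf1.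
by rewrite gmulfF fa fb divgg.
Qed.

Lemma normal_closure_kernel (A : set G) :
  (forall a, A a -> f a = 1) -> forall a, normal_closure A a -> f a = 1.
Proof. by move=> fA; apply: smallest_sub fA; apply: kernel_normal. Qed.

End Preimages.

(** * The quotient of a group by a normal subgroup *)

Section Quotient.
Variables (G : groupType) (K : set G).
Hypothesis nK : is_normal_subgroup K.

(** Made boolean by classical reflection, since [{eq_quot _}] takes a boolean equivalence. *)
Definition coset_rel (a b : G) : bool := `[< K (a / b) >].

Lemma coset_rel_equiv : equiv_class_of coset_rel.
Proof.
have sK := nK.1.
split=> [a|a b|b a c]; first by apply/asboolP; rewrite divgg; apply: sK.1.
  by apply/asboolP/asboolP=> /(is_subgroupV sK); rewrite invgF.
move=> /asboolP Kab /asboolP Kbc; apply/asboolP.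
by rewrite -(divgKA b); apply: is_subgroupM.
Qed.

Canonical coset_equiv := EquivRelPack coset_rel_equiv.

Definition quotient_group : Type := {eq_quot coset_rel}%qT.
HB.instance Definition _ := Choice.on quotient_group.

Definition quot_pi (a : G) : quotient_group := (\pi_({eq_quot coset_rel}) a)%qT.
Definition quot_repr (p : quotient_group) : G := repr p.

Lemma quot_reprK : cancel quot_repr quot_pi.
Proof. exact: reprK. Qed.

Lemma quot_pi_eq a b : quot_pi a = quot_pi b <-> K (a / b).
Proof.
split=> [/eqmodP/asboolP//|Kab].
by apply/eqmodP/asboolP.
Qed.

Lemma quot_repr_pi a : K (quot_repr (quot_pi a) / a).
Proof. by apply/quot_pi_eq; rewrite quot_reprK. Qed.

Definition quot_mul (p q : quotient_group) := quot_pi (quot_repr p * quot_repr q).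
Definition quot_inv (p : quotient_group) := quot_pi (quot_repr p)^-1.

Lemma quot_piM a b : quot_pi (a * b) = quot_mul (quot_pi a) (quot_pi b).
Proof.
apply/esym/quot_pi_eq; rewrite invgM mulgA.
set a' := quot_repr _; set b' := quot_repr _.
(* Normality enters here: the discrepancy [b' / b] has to be carried past [a]. *)
have -> : a' * b' / b / a = (a' / a) * (b' / b) ^ a^-1.
  by rewrite conjgE invgK !group_mulA mulgVK.
by apply: is_subgroupM nK.1 (quot_repr_pi a) _; apply/nK.2/quot_repr_pi.
Qed.

Lemma quot_piV a : quot_pi a^-1 = quot_inv (quot_pi a).
Proof.
apply/quot_pi_eq; rewrite invgK.
by have := nK.2 _ a (quot_repr_pi a); rewrite conjgE mulgVK.
Qed.

Lemma quot_mulA : associative quot_mul.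
Proof.
move=> p q r; rewrite -[p]quot_reprK -[q]quot_reprK -[r]quot_reprK.
by rewrite -!quot_piM mulgA.
Qed.

Lemma quot_mul1g : left_id (quot_pi 1) quot_mul.
Proof. by move=> p; rewrite -[p]quot_reprK -quot_piM mul1g. Qed.

Lemma quot_mulg1 : right_id (quot_pi 1) quot_mul.
Proof. by move=> p; rewrite -[p]quot_reprK -quot_piM mulg1. Qed.

Lemma quot_mulVg : left_inverse (quot_pi 1) quot_inv quot_mul.
Proof. by move=> p; rewrite -[p]quot_reprK -quot_piV -quot_piM mulVg. Qed.

Lemma quot_mulgV : right_inverse (quot_pi 1) quot_inv quot_mul.
Proof. by move=> p; rewrite -[p]quot_reprK -quot_piV -quot_piM mulgV. Qed.

HB.instance Definition _ :=
  isGroup.Build quotient_group quot_mulA quot_mul1g quot_mulg1 quot_mulVg quot_mulgV.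

Fact quot_pi_morphism : monoid_morphism quot_pi.
Proof. by split=> // a b; apply: quot_piM. Qed.

HB.instance Definition _ :=
  isUMagmaMorphism.Build G quotient_group quot_pi quot_pi_morphism.

Lemma quot_pi_eq1 a : quot_pi a = 1 <-> K a.
Proof. by rewrite quot_pi_eq divg1. Qed.

End Quotient.

(** * Morphisms out of free and presented groups *)

Section FreeGroupMorphisms.
Variable X : choiceType.
Implicit Types (u : freegroup X) (G H : groupType).

(** Induction on the reduced word: as the whole word is reduced, pushing its first letter onto its
    tail cancels nothing. *)
Lemma freegroup_ind (P : freegroup X -> Prop) :
  P 1 -> (forall x u, P u -> P (fg_gen x * u)) ->
  (forall x u, P u -> P ((fg_gen x)^-1 * u)) -> forall u, P u.
Proof.
move=> P1 Pgen PgenV [w]; elim: w => [|[x b] w IHw] red_w.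
  by rewrite (_ : FreeGroup _ = 1) //; apply/val_inj.
have red_w' := reduced_cons red_w.
suff -> : FreeGroup red_w =
    (if b then (fg_gen x)^-1 else fg_gen x) * FreeGroup red_w'.
  by case: (b); auto.
by apply/val_inj; case: b red_w => red_w; rewrite /= push_cons.
Qed.

Lemma freegroup_morph_ext G (f g : UMagmaMorphism.type (freegroup X) G) :
  (forall x, f (fg_gen x) = g (fg_gen x)) -> f =1 g.
Proof.
move=> fg; elim/freegroup_ind => [|x u IHu|x u IHu]; first by rewrite !gmulf1.
  by rewrite !gmulfM IHu fg.
by rewrite !gmulfM !gmulfV IHu fg.
Qed.

Lemma fg_eval_comp G H (phi : X -> G) (f : UMagmaMorphism.type G H) u :
  f (fg_eval phi u) = fg_eval (f \o phi) u.
Proof.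
by move: u; apply: (freegroup_morph_ext (f := f \o fg_eval phi)) => x /=;
   rewrite !fg_eval_gen.
Qed.

Lemma fg_eval_map G (Y : choiceType) (phi : Y -> G) (h : X -> Y) u :
  fg_eval phi (fg_map h u) = fg_eval (phi \o h) u.
Proof.
rewrite /fg_map fg_eval_comp; congr (fg_eval _ u).
by apply/funext => x /=; rewrite fg_eval_gen.
Qed.

Lemma fg_eval_idfun u : fg_eval (@fg_gen X) u = u.
Proof.
move: u; apply: (freegroup_morph_ext (f := fg_eval _) (g := idfun)) => x.
exact: fg_eval_gen.
Qed.

Lemma fg_eval_surj G (phi : X -> G) :
  subgroup_gen (range phi) = setT -> forall g, exists u, fg_eval phi u = g.
Proof.
move=> gen_phi g; have : subgroup_gen (range phi) g by rewrite gen_phi.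
suff: subgroup_gen (range phi) `<=` range (fg_eval phi).
  by move=> sub /sub [u _ <-]; exists u.
apply: smallest_sub; first exact: is_subgroup_range.
by move=> _ [x _ <-]; exists (fg_gen x); rewrite ?fg_eval_gen.
Qed.

(** The kernel of evaluation is the normal closure of [R], which [f] kills, so [f] factors through
    [G]. The induced map is [f] after a chosen section [w] of evaluation. *)
Lemma von_dyck G H (gen : X -> G) (R : set (freegroup X))
    (f : UMagmaMorphism.type (freegroup X) H) :
    presentation gen R -> (forall r, R r -> f r = 1) ->
  exists i : UMagmaMorphism.type G H, forall u, i (fg_eval gen u) = f u.
Proof.
move=> [gen_phi kerR] fR.
have /choice [w wK] := fg_eval_surj gen_phi.
have f_eq u v : fg_eval gen u = fg_eval gen v -> f u = f v.
  move=> uv; apply/divg1_eq; rewrite -gmulfF; apply: normal_closure_kernel fR _ _.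
  by rewrite -kerR /= gmulfF /= uv divgg.
have fw_morph : monoid_morphism (f \o w).
  split=> [|a b] /=.
    have <- : f 1 = 1 by rewrite gmulf1.
    by apply: f_eq; rewrite wK gmulf1.
  by rewrite -gmulfM; apply: f_eq; rewrite gmulfM /= !wK.
pose fwM := isUMagmaMorphism.Build _ _ _ fw_morph.
pose i : UMagmaMorphism.type G H := HB.pack (f \o w) fwM.
by exists i => u /=; apply: f_eq; rewrite wK.
Qed.

End FreeGroupMorphisms.

(** * Embeddings into the wreath product, and its generation *)

Section WreathMorphisms.
Variables H G : groupType.
Implicit Types (f g : wr_base H G) (h : H) (a b c : G).

Lemma wr_baseM f g a : base_fun (f * g) a = f a * base_fun g a.
Proof. exact: base_mulE. Qed.

Lemma wr_base1 a : base_fun (1 : wr_base H G) a = 1.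
Proof. exact: base_oneE. Qed.

Lemma wr_baseV f a : base_fun f^-1 a = (f a)^-1.
Proof. exact: base_invE. Qed.

Fact wr_inbase_morphism : monoid_morphism (@wr_inbase H G).
Proof.
by split=> // f g; congr Wreath; rewrite /= ?base_act1 ?mulg1.
Qed.

HB.instance Definition _ :=
  isUMagmaMorphism.Build (wr_base H G) (wreath H G) (@wr_inbase H G)
    wr_inbase_morphism.

Fact wr_intop_morphism : monoid_morphism (@wr_intop H G).
Proof. by split=> // a b; congr Wreath; rewrite /= base_act_one mul1g. Qed.

HB.instance Definition _ :=
  isUMagmaMorphism.Build G (wreath H G) (@wr_intop H G) wr_intop_morphism.

(** The argument order makes [wr_at a] the embedding of [H] as the coordinate factor at [a]. *)
Definition wr_at a h : wreath H G := wr_inbase (base_single h a).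

Fact base_single_morphism a : monoid_morphism (fun h => base_single h a).
Proof.
split=> [|h k]; apply/base_eqP => b; rewrite ?wr_baseM ?wr_base1 !base_singleE.
  by case: ifP.
by case: ifP; rewrite ?mulg1.
Qed.

Fact wr_at_morphism a : monoid_morphism (wr_at a).
Proof.
split=> [|h k]; rewrite /wr_at; first by rewrite (base_single_morphism a).1 gmulf1.
by rewrite (base_single_morphism a).2 gmulfM.
Qed.

HB.instance Definition _ a :=
  isUMagmaMorphism.Build H (wreath H G) (wr_at a) (wr_at_morphism a).

Lemma wr_atJ a h c : wr_at a h ^ wr_intop H c = wr_at (a * c) h.
Proof. exact: wr_conj_single. Qed.

Lemma wr_inbase_commute f g :
  (forall a, commute (f a) (g a)) -> commute (wr_inbase f) (wr_inbase g).
Proof.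
move=> fg; apply/gmulf_commute/base_eqP => a; rewrite !wr_baseM; exact: fg.
Qed.

Lemma wr_at_commute a b h k : a != b -> commute (wr_at a h) (wr_at b k).
Proof.
move=> ab; apply: wr_inbase_commute => c; rewrite !base_singleE.
have [->|_] := eqVneq c a; last exact/commute_sym/commute1.
by rewrite (negPf ab); apply: commute1.
Qed.

Lemma wreath_split (w : wreath H G) :
  w = wr_inbase (wr_fst w) * wr_intop H (wr_snd w).
Proof. by case: w => f c; congr Wreath; rewrite /= ?base_act1 ?mulg1 ?mul1g. Qed.

(** Conjugation by the top group carries the factor at 1 to every coordinate, and a finitely
    supported function is a product of elements of these factors. *)
Lemma wreath_subgroup_full (K : set (wreath H G)) : is_subgroup K ->
  (forall c, K (wr_intop H c)) -> (forall h, K (wr_at 1 h)) -> K = setT.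
Proof.
move=> sK Ktop Kat; apply/seteqP; split=> // w _; rewrite [w]wreath_split.
apply: is_subgroupM => //; move: (wr_fst w) => f.
have {}Kat a h : K (wr_at a h).
  rewrite -[a]mul1g -wr_atJ conjgE.
  by do 2?apply: is_subgroupM => //; apply: is_subgroupV.
(* The list only has to contain the support, so the induction may drop one point at a time. *)
suff: forall (s : seq G) f, (forall a, a \notin s -> f a = 1) -> K (wr_inbase f).
  by apply; first exact: (@base_out _ _ f).
elim=> {f} [|a s IHs] f f_out.
  rewrite (_ : f = 1) ?gmulf1; first exact: sK.1.
  by apply/base_eqP => a; rewrite wr_base1 f_out.
(* Dividing by the value at [a] leaves a function supported in [s]. *)
rewrite -[f](mulVKg (base_single (f a) a)) gmulfM.
apply: is_subgroupM => //; first exact: Kat.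
apply: IHs => b b_s; rewrite wr_baseM wr_baseV base_singleE.
have [->|b_a] := eqVneq b a; first by rewrite mulVg.
by rewrite invg1 mul1g f_out // inE negb_or b_a.
Qed.

End WreathMorphisms.

(** * Collecting words into products of conjugates *)

Section NormalForm.
Variables (G H Q : groupType).
Variables (i : UMagmaMorphism.type G Q) (j : UMagmaMorphism.type H Q).
Implicit Types (L : seq (H * G)) (g a c : G).

(** Coordinates may repeat in [L], so this form is not unique; it only separates the base part from
    the top part. *)
Definition normal_form L c : Q := (\prod_(p <- L) j p.1 ^ i p.2) * i c.

(** Moving [i g] to the right past the product conjugates each factor by [i g^-1]. *)
Lemma normal_form_top g L c :
  i g * normal_form L c =
  normal_form [seq (p.1, p.2 * g^-1) | p <- L] (g * c).
Proof.
rewrite /normal_form big_map gmulfM !mulgA; congr (_ * _).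
rewrite conjgCV conjg_prod; congr (_ * _); apply: eq_bigr => p _ /=.
by rewrite gmulfM gmulfV conjgM.
Qed.

Lemma normal_form_base h L c :
  j h * normal_form L c = normal_form ((h, 1) :: L) c.
Proof. by rewrite /normal_form big_cons /= gmulf1 conjg1 mulgA. Qed.

Hypothesis comm_ij : forall g h k, g != 1 -> commute (j h) (j k ^ i g).

Let comm_conj (p q : H * G) :
  p.2 != q.2 -> commute (j p.1 ^ i p.2) (j q.1 ^ i q.2).
Proof.
move=> pq.
have -> : j q.1 ^ i q.2 = (j q.1 ^ i (q.2 / p.2)) ^ i p.2.
  by rewrite -conjgM -gmulfM mulgVK.
rewrite /commute -!conjMg comm_ij // divg_eq1 eq_sym //.
Qed.

(** Factors with coordinate [a] commute with all the others, so they can be gathered in front. *)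
Let prod_split L a :
  \prod_(p <- L) j p.1 ^ i p.2 =
  (\prod_(p <- L | p.2 == a) j p.1 ^ i p.2) *
  \prod_(p <- L | p.2 != a) j p.1 ^ i p.2.
Proof.
elim: L => [|p L IHL]; first by rewrite !big_nil mulg1.
rewrite !big_cons IHL; case: eqVneq => [pa|pa] /=; first by rewrite mulgA.
rewrite [LHS]group_mulA [RHS]group_mulA; congr (_ * _).
apply: commute_prod => q /eqP qa.
by apply: comm_conj; rewrite qa.
Qed.

(** Strong induction on the length of [L]: the factors sharing the coordinate of the head are
    gathered, and their product is a conjugate of the image under [j] of a trivial product. The
    remaining list is shorter. *)
Lemma normal_form_trivial L :
  (forall a, \prod_(p <- L | p.2 == a) p.1 = 1) -> normal_form L 1 = 1.
Proof.
rewrite /normal_form gmulf1 mulg1.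
have [n] := ubnP (size L); elim: n L => // n IHn [|p L] szL L1.
  by rewrite big_nil.
rewrite (prod_split _ p.2).
rewrite (eq_bigr (fun q => j q.1 ^ i p.2)) => [|q /eqP-> //].
rewrite -conjg_prod -gmulf_prod L1 gmulf1 conj1g mul1g.
rewrite -big_filter; apply: IHn => [|a].
  rewrite /= eqxx /= size_filter; apply: leq_ltn_trans (count_size _ _) _.
  by rewrite ltnS in szL.
(* Filtering empties the product at [p.2] and leaves the products at other coordinates unchanged. *)
rewrite big_filter_cond; have [->|pa] := eqVneq a p.2.
  by rewrite big_pred0 // => q; rewrite andNb.
rewrite -[RHS](L1 a); apply: eq_bigl => q.
by case: (eqVneq q.2 a) => [->|_]; rewrite ?andbT ?andbF.
Qed.

End NormalForm.

(** In the wreath product itself, conjugating the factor at 1 by [a] gives the factor at [a], so a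
    normal form displays its base and top components. *)
Lemma wreath_normal_form (H G : groupType) (L : seq (H * G)) (c : G) :
  normal_form (@wr_intop H G) (wr_at 1) L c =
  wr_inbase (\prod_(p <- L) base_single p.1 p.2) * wr_intop H c.
Proof.
rewrite /normal_form gmulf_prod; congr (_ * _).
by apply: eq_bigr => p _; rewrite /= wr_atJ mul1g.
Qed.

Lemma prod_base_singleE (H G : groupType) (L : seq (H * G)) (a : G) :
  base_fun (\prod_(p <- L) base_single p.1 p.2) a = \prod_(p <- L | p.2 == a) p.1.
Proof.
elim: L => [|p L IHL]; first by rewrite !big_nil wr_base1.
rewrite !big_cons wr_baseM IHL base_singleE eq_sym.
by case: eqP => //; rewrite mul1g.
Qed.

(** * Evaluation of words on the generators of the wreath product *)

Section WreathPresentation.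
Variables (G H : groupType) (X Y : choiceType) (gX : X -> G) (gY : Y -> H).
Implicit Types (r : freegroup (X + Y)%type).

Lemma wreath_eval_inl u :
  fg_eval (wreath_gen gX gY) (fg_map inl u) = wr_intop H (fg_eval gX u).
Proof. by rewrite fg_eval_map fg_eval_comp. Qed.

Lemma wreath_eval_inr v :
  fg_eval (wreath_gen gX gY) (fg_map inr v) = wr_at 1 (fg_eval gY v).
Proof. by rewrite fg_eval_map fg_eval_comp. Qed.

Lemma wreath_gen_full : subgroup_gen (range gX) = setT ->
  subgroup_gen (range gY) = setT ->
  subgroup_gen (range (wreath_gen gX gY)) = setT.
Proof.
move=> genX genY; have sK := subgroup_gen_subgroup (range (wreath_gen gX gY)).
have evalK u : subgroup_gen (range (wreath_gen gX gY)) (fg_eval (wreath_gen gX gY) u).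
  elim/freegroup_ind: u => [|x u IHu|x u IHu]; first by rewrite gmulf1; apply: sK.1.
    rewrite gmulfM /= fg_eval_gen; apply: (is_subgroupM sK) => //.
    by apply: sub_subgroup_gen; exists x.
  rewrite gmulfM gmulfV /= fg_eval_gen; apply: (is_subgroupM sK) => //.
  by apply: (is_subgroupV sK); apply: sub_subgroup_gen; exists x.
apply: wreath_subgroup_full => // [c|h].
  by have [u <-] := fg_eval_surj genX c; rewrite -wreath_eval_inl.
by have [v <-] := fg_eval_surj genY h; rewrite -wreath_eval_inr.
Qed.

(** The same [L] and [c] serve in [Q] and in the wreath product, because both are built by the same
    rules from the letters of [u]. This lets triviality in the wreath product be transferred to
    [Q]. *)
Lemma normal_form_exists (Q : groupType) (i : UMagmaMorphism.type G Q)
    (j : UMagmaMorphism.type H Q) (pi : UMagmaMorphism.type (freegroup (X + Y)%type) Q) :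
    (forall x, pi (fg_gen (inl x)) = i (gX x)) ->
    (forall y, pi (fg_gen (inr y)) = j (gY y)) ->
  forall u, exists L c, pi u = normal_form i j L c /\
    fg_eval (wreath_gen gX gY) u = normal_form (@wr_intop H G) (wr_at 1) L c.
Proof.
move=> pi_inl pi_inr; elim/freegroup_ind => [|s u|s u].
- by exists [::], 1; rewrite /normal_form !big_nil !gmulf1 !mulg1.
- move=> [L [c [piu evu]]]; rewrite !gmulfM piu /= evu fg_eval_gen.
  case: s => [x|y].
    by rewrite pi_inl !normal_form_top; do 2!eexists.
  rewrite pi_inr -[wreath_gen _ _ _]/(wr_at 1 (gY y)).
  by rewrite !normal_form_base; do 2!eexists.
- move=> [L [c [piu evu]]]; rewrite !gmulfM !gmulfV piu /= evu.
  rewrite fg_eval_gen; case: s => [x|y].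
    by rewrite pi_inl -!gmulfV !normal_form_top; do 2!eexists.
  rewrite pi_inr -[wreath_gen _ _ _]/(wr_at 1 (gY y)).
  by rewrite -!gmulfV !normal_form_base; do 2!eexists.
Qed.

End WreathPresentation.

(** * Test morphisms for the independence of relators *)

Lemma fg_eval_one (X : choiceType) (G : groupType) (u : freegroup X) :
  fg_eval (fun _ : X => 1 : G) u = 1.
Proof.
elim/freegroup_ind: u => [|x u IHu|x u IHu]; first exact: gmulf1.
  by rewrite gmulfM /= IHu fg_eval_gen mulg1.
by rewrite gmulfM gmulfV /= IHu fg_eval_gen invg1 mulg1.
Qed.

Lemma wr_at_eq1 (H G : groupType) (a : G) (h : H) : wr_at a h = 1 -> h = 1.
Proof.
by move=> /(congr1 (fun w => base_fun (wr_fst w) a)); rewrite /= base_singleE eqxx wr_base1.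
Qed.

(** Each independence proof below reduces to exhibiting such an [f]: its kernel is normal and
    contains the other relators. *)
Lemma minimal_relator (X : choiceType) (G : groupType)
    (f : UMagmaMorphism.type (freegroup X) G) (R : set (freegroup X))
    (r : freegroup X) :
  (forall q, R q -> q <> r -> f q = 1) -> f r <> 1 -> ~ normal_closure (R `\ r) r.
Proof.
by move=> fR fr /(normal_closure_kernel (f := f)) fr1; apply/fr/fr1 => q [/fR].
Qed.

Section TwoCopies.
Variables (H P G : groupType).
Variables (lam mu : UMagmaMorphism.type H P) (c : G).
Hypothesis c_neq1 : c != 1.

(** The two factors lie at distinct coordinates when [c] is not 1, hence commute; this makes the map
    a morphism. *)
Definition two_copies (h : H) : wreath P G := wr_at 1 (lam h) * wr_at c (mu h).

Fact two_copies_morphism : monoid_morphism two_copies.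
Proof.
split=> [|h k]; rewrite /two_copies; first by rewrite !gmulf1 mulg1.
rewrite !gmulfM -!mulgA; congr (_ * _); rewrite !mulgA; congr (_ * _).
by apply: wr_at_commute; rewrite eq_sym.
Qed.

Lemma two_copiesJ h t :
  two_copies h ^ wr_intop P t = wr_at t (lam h) * wr_at (c * t) (mu h).
Proof. by rewrite conjMg !wr_atJ mul1g. Qed.

(** The supports lie in {1, c} and {t, ct}. Under the hypotheses they can meet only when ct = 1, and
    there [lam h] faces [mu k]. *)
Lemma two_copies_commute h k t : t != 1 -> t != c ->
    (c * t = 1 -> commute (lam h) (mu k)) ->
  commute (two_copies h) (two_copies k ^ wr_intop P t).
Proof.
move=> t1 tc lam_mu; rewrite two_copiesJ; apply: commuteM.
  apply/commute_sym/commuteM; first exact: wr_at_commute.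
  exact: wr_at_commute.
apply/commute_sym/commuteM.
  have [ct1|ct1] := eqVneq (c * t) 1; last exact: wr_at_commute.
  by rewrite ct1; apply/gmulf_commute/commute_sym/lam_mu.
apply: wr_at_commute; apply: contra_neq t1 => ct.
by apply: (mulgI c); rewrite mulg1.
Qed.

(** Read at coordinate 1: the left element has value [lam h] there, and the conjugate, living at
    c^-1 and 1, has value [mu k]. *)
Lemma two_copies_commuteV h k :
  commute (two_copies h) (two_copies k ^ wr_intop P c^-1) ->
  commute (lam h) (mu k).
Proof.
rewrite two_copiesJ mulgV /two_copies /wr_at /commute -!gmulfM.
move=> /(congr1 (fun w => base_fun (wr_fst w) 1)).
rewrite !wr_baseM !base_singleE eqxx !(eq_sym 1) invg_eq1 (negPf c_neq1).
by rewrite !mulg1 !mul1g.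
Qed.

End TwoCopies.

(* In A wr B a nontrivial element of the first copy of A commutes with no
   nontrivial element of B. *)
Lemma noncommuting_quotients (H : groupType) (M N : set H) (h k : H) :
    is_normal_subgroup M -> is_normal_subgroup N -> ~ M h -> ~ N k ->
  exists (P : groupType) (lam mu : UMagmaMorphism.type H P),
    [/\ forall a, M a -> lam a = 1, forall a, N a -> mu a = 1
      & ~ commute (lam h) (mu k)].
Proof.
move=> nM nN Mh Nk.
pose A := quotient_group nM; pose B := quotient_group nN.
exists (wreath A B), (@wr_at A B 1 \o quot_pi nM), (@wr_intop A B \o quot_pi nN).
split=> [a Ma|a Na|].
- by have /= -> := (quot_pi_eq1 nM a).2 Ma; rewrite gmulf1.
- by have /= -> := (quot_pi_eq1 nN a).2 Na; rewrite gmulf1.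
move=> /= /commgP /conjg_fixP; rewrite wr_atJ mul1g.
move=> /(congr1 (fun w => base_fun (wr_fst w) 1)).
rewrite /= !base_singleE eqxx; case: eqP => [/esym/quot_pi_eq1//|_].
by move=> /esym/quot_pi_eq1.
Qed.

(** * Minimality of the generating set *)

Section WreathGenerators.
Variables (H G : groupType).

Fact wr_snd_morphism : monoid_morphism (@wr_snd H G).
Proof. by []. Qed.

HB.instance Definition _ :=
  isUMagmaMorphism.Build (wreath H G) G (@wr_snd H G) wr_snd_morphism.

(** The action only permutes coordinates, so a condition imposed on all of them is stable. *)
Lemma wreath_base_subgroup (N : set H) : is_subgroup N ->
  is_subgroup [set w : wreath H G | forall a, N (wr_fst w a)].
Proof.
move=> sN; split=> [a|[f c] [g d] /= Nf Ng a]; first by rewrite wr_base1; apply: sN.1.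
rewrite !(base_mulE, base_actE, base_invE); apply: sN.2; first exact: Nf.
exact: Ng.
Qed.

(** A missing [x] is detected by projecting to [G], which kills [Y]. A missing [y] is detected by
    the subgroup of elements whose base values lie in the normal closure of the other generators of
    [H]: it contains all of [A], but by conormality not y(1). *)
Lemma wreath_minimal_generators (X Y : choiceType) (gX : X -> G) (gY : Y -> H)
    (A : set (X + Y)%type) :
    (forall A : set X, A `<` setT -> subgroup_gen (gX @` A) <> setT) ->
    conormal gY -> A `<` setT ->
  subgroup_gen (wreath_gen gX gY @` A) <> setT.
Proof.
move=> minX conY [_ /existsNP[s /not_implyP[_ As]]] genA.
case: s As => [x|y] As.
  apply: (minX (inl @^-1` A)); first by split=> // /(_ x I).
  apply/seteqP; split=> // c _; rewrite -[c]/(wr_snd (wr_intop H c)).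
  have: subgroup_gen (wreath_gen gX gY @` A) (wr_intop H c) by rewrite genA.
  move: (wr_intop H c).
  apply: (@smallest_sub _ _ _ (@wr_snd H G @^-1` subgroup_gen (gX @` (inl @^-1` A)))).
    exact/is_subgroup_preimage/subgroup_gen_subgroup.
  move=> _ [[x'|y'] As' <-] /=; first by apply: sub_subgroup_gen; exists x'.
  exact: (subgroup_gen_subgroup _).1.
have sN := (normal_closure_normal (gY @` [set~ y])).1.
apply: (conY y).
have: subgroup_gen (wreath_gen gX gY @` A) (wr_at 1 (gY y)) by rewrite genA.
move=> /(smallest_sub (wreath_base_subgroup sN)) sub.
have /(_ 1) : forall a : G, normal_closure (gY @` [set~ y]) (base_single (gY y) (1 : G) a).
  apply: sub => _ [[x'|y'] As' <-] a /=; first by rewrite wr_base1; apply: sN.1.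
  rewrite base_singleE; case: ifP => _; last exact: sN.1.
  by apply: sub_normal_closure; exists y' => // yy'; rewrite yy' in As'.
by rewrite base_singleE eqxx.
Qed.

End WreathGenerators.

(** * The presentation, and independence of its relators *)

Section WreathRelations.
Variables (G H : groupType) (X Y : choiceType) (gX : X -> G) (gY : Y -> H).
Variables (R : set (freegroup X)) (S : set (freegroup Y)).
Variables (T : set G) (word : G -> freegroup X).
Hypothesis presG : presentation gX R.
Hypothesis presH : presentation gY S.
Hypothesis T_neq1 : forall t, T t -> t != 1.
Hypothesis wordP : forall t, T t -> fg_eval gX (word t) = t.

Let gXR u : R u -> fg_eval gX u = 1.
Proof.
by move=> Ru; have : normal_closure R u by [apply: sub_normal_closure];
   rewrite -presG.2.
Qed.

Let gYS v : S v -> fg_eval gY v = 1.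
Proof.
by move=> Sv; have : normal_closure S v by [apply: sub_normal_closure];
   rewrite -presH.2.
Qed.

(** The target [H'] is arbitrary because the fact serves both for [H] and for a quotient of the free
    group on [Y]. *)
Lemma wreath_eval_comm (H' : groupType) (g : Y -> H') y z t : T t ->
  fg_eval (wreath_gen gX g)
    [~ fg_gen (inr y), fg_gen (inr z) ^ fg_map inl (word t)] = 1.
Proof.
move=> Tt; rewrite gmulfR gmulfJ /= !fg_eval_gen wreath_eval_inl wordP //=.
by apply/eqP/commgP; rewrite wr_atJ mul1g; apply: wr_at_commute; rewrite eq_sym T_neq1.
Qed.

Lemma wreath_rel_eval1 r : wreath_rel R S T word r -> fg_eval (wreath_gen gX gY) r = 1.
Proof.
move=> [[[u Ru <-]|[v Sv <-]]|[y [z [t [Tt ->]]]]].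
- by rewrite wreath_eval_inl gXR.
- by rewrite wreath_eval_inr gYS ?gmulf1.
- exact: wreath_eval_comm.
Qed.

Lemma commute_conjugates (Q : groupType) (i : UMagmaMorphism.type G Q)
    (j : UMagmaMorphism.type H Q) :
    T `|` [set t^-1 | t in T] = [set~ 1] ->
    (forall y z t, T t -> commute (j (gY y)) (j (gY z) ^ i t)) ->
  forall g h k, g != 1 -> commute (j h) (j k ^ i g).
Proof.
move=> T_cover comm_gen.
have comm_T t h k : T t -> commute (j h) (j k ^ i t).
  move=> Tt.
  have gen_ind (K : set H) : is_subgroup K -> (forall y, K (gY y)) -> forall a, K a.
    move=> sK Kg a; have : subgroup_gen (range gY) a by rewrite presH.1.
    by apply: smallest_sub => // _ [y _ <-].
  (* First the left argument runs over [H] with a generator on the right; then the right argument is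
     extended. *)
  have comm_h y a : commute (j a) (j (gY y) ^ i t).
    move: a; apply: gen_ind => [|z]; last exact: comm_gen.
    exact: (is_subgroup_preimage j (is_subgroup_centralizer _)).
  apply: (gen_ind [set a | commute (j h) (j a ^ i t)]) => [|y]; last exact: comm_h.
  split=> [|a b] /=; first by rewrite gmulf1 conj1g; apply: commute1.
  rewrite gmulfM gmulfV conjMg conjVg => ha hb.
  by apply: commuteM => //; apply: commuteV.
move=> g h k /eqP g1; have : (T `|` [set t^-1 | t in T]) g by rewrite T_cover.
case=> [Tg|[t Tt <-]]; first exact: comm_T.
(* Conjugating by [i t] turns the claim for t^-1 into the one for t with [h] and [k] exchanged. *)
have -> : j h = (j h ^ i t) ^ i t^-1 by rewrite gmulfV conjgK.
by rewrite /commute -!conjMg; congr (_ ^ _); apply/commute_sym/comm_T.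
Qed.

Lemma wreath_presentation : T `|` [set t^-1 | t in T] = [set~ 1] ->
  presentation (wreath_gen gX gY) (wreath_rel R S T word).
Proof.
move=> T_cover; split; first exact: wreath_gen_full presG.1 presH.1.
set N := normal_closure _; apply/seteqP; split; last first.
  by move=> r; apply: normal_closure_kernel wreath_rel_eval1 r.
move=> u /= eval_u.
have nN : is_normal_subgroup N by apply: normal_closure_normal.
have relN r : wreath_rel R S T word r -> quot_pi nN r = 1.
  by move=> rel_r; apply/(quot_pi_eq1 nN); apply: sub_normal_closure.
(* Von Dyck gives morphisms [i] and [j] from [G] and [H] to the group presented by the relators. *)
have [|i i_eval] := von_dyck presG
    (f := quot_pi nN \o fg_eval (fun x => fg_gen (inl x))).
  by move=> r Rr; apply: relN; left; left; exists r.
have [|j j_eval] := von_dyck presH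
    (f := quot_pi nN \o fg_eval (fun y => fg_gen (inr y))).
  by move=> r Sr; apply: relN; left; right; exists r.
have pi_inl x : quot_pi nN (fg_gen (inl x)) = i (gX x).
  by rewrite -[gX x](fg_eval_gen gX) i_eval /= fg_eval_gen.
have pi_inr y : quot_pi nN (fg_gen (inr y)) = j (gY y).
  by rewrite -[gY y](fg_eval_gen gY) j_eval /= fg_eval_gen.
have comm_ij : forall g h k, g != 1 -> commute (j h) (j k ^ i g).
  apply: commute_conjugates => // y z t Tt; apply/commgP/eqP.
  rewrite -(wordP Tt) i_eval -!pi_inr -gmulfJ -gmulfR.
  by apply: relN; right; exists y, z, t.
have [L [c [pi_u]]] := normal_form_exists pi_inl pi_inr u.
rewrite eval_u wreath_normal_form => eval_L.
have c1 : c = 1 by have := congr1 (@wr_snd H G) eval_L; rewrite /= mul1g.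
apply/(quot_pi_eq1 nN); rewrite pi_u c1; apply: normal_form_trivial => // a.
(* Triviality in the wreath product now says that the entries of [L] multiply to 1 at each
   coordinate. *)
rewrite c1 gmulf1 mulg1 in eval_L.
rewrite -prod_base_singleE; have /= <- := congr1 (@wr_fst H G) eval_L.
exact: wr_base1.
Qed.

Lemma wreath_minimal_base_relator v :
  ~ normal_closure (S `\ v) v ->
  ~ normal_closure (wreath_rel R S T word `\ fg_map inr v) (fg_map inr v).
Proof.
have nN := normal_closure_normal (S `\ v) => Nv.
pose g y := quot_pi nN (fg_gen y).
have eval_g w : fg_eval g w = quot_pi nN w by rewrite -fg_eval_comp fg_eval_idfun.
apply: (minimal_relator (f := fg_eval (wreath_gen gX g))); last first.
  by rewrite /= wreath_eval_inr => /wr_at_eq1; rewrite eval_g => /quot_pi_eq1.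
move=> _ [[[u Ru <-]|[w Sw <-]]|[y [z [t [Tt ->]]]]] neq_v /=.
- by rewrite wreath_eval_inl gXR.
- rewrite wreath_eval_inr eval_g (_ : quot_pi nN w = 1) ?gmulf1 //.
  apply/(quot_pi_eq1 nN); apply: sub_normal_closure; split=> // wv.
  by rewrite wv in neq_v.
- exact: wreath_eval_comm.
Qed.

Lemma wreath_minimal_top_relator u :
  ~ normal_closure (R `\ u) u ->
  ~ normal_closure (wreath_rel R S T word `\ fg_map inl u) (fg_map inl u).
Proof.
have nN := normal_closure_normal (R `\ u) => Nu.
pose g (s : X + Y) := if s is inl x then quot_pi nN (fg_gen x) else 1.
have eval_g w : fg_eval g (fg_map inl w) = quot_pi nN w.
  by rewrite fg_eval_map -[X in fg_eval X](_ : quot_pi nN \o @fg_gen X = _) //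
     -fg_eval_comp fg_eval_idfun.
apply: (minimal_relator (f := fg_eval g)).
  move=> _ [[[w Rw <-]|[v Sv <-]]|[y [z [t [Tt ->]]]]] neq_u /=.
  - rewrite eval_g; apply/(quot_pi_eq1 nN); apply: sub_normal_closure; split=> // wu.
    by rewrite wu in neq_u.
  - by rewrite fg_eval_map; apply: fg_eval_one.
  (* The first entry of the commutator is sent to 1. *)
  - by rewrite gmulfR /= fg_eval_gen comm1g.
by rewrite /= eval_g => /quot_pi_eq1.
Qed.

Lemma wreath_minimal_commutator y0 z0 t0 (r := [~ fg_gen (inr y0),
    fg_gen (inr z0) ^ fg_map inl (word t0)] : freegroup (X + Y)%type) :
  conormal gY -> T t0 -> (forall t, T t -> ~ T t^-1) ->
  ~ normal_closure (wreath_rel R S T word `\ r) r.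
Proof.
move=> conY Tt0 T_antisym.
have [P [lam [mu [lam1 mu1 lam_mu]]]] := noncommuting_quotients
  (normal_closure_normal _) (normal_closure_normal _) (conY y0) (conY z0).
have c1 : t0^-1 != 1 by rewrite invg_eq1 T_neq1.
(* The second copy sits at t0^-1, so that conjugation by t0 brings it onto coordinate 1. *)
pose D : UMagmaMorphism.type H (wreath P G) := HB.pack (two_copies lam mu t0^-1)
  (isUMagmaMorphism.Build _ _ _ (two_copies_morphism lam mu c1)).
pose g (s : X + Y) :=
  match s with inl x => wr_intop P (gX x) | inr y => D (gY y) end.
have g_inl u : fg_eval g (fg_map inl u) = wr_intop P (fg_eval gX u).
  by rewrite fg_eval_map fg_eval_comp.
have g_inr v : fg_eval g (fg_map inr v) = D (fg_eval gY v).
  by rewrite fg_eval_map fg_eval_comp.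
have g_comm y z t : T t ->
    fg_eval g [~ fg_gen (inr y), fg_gen (inr z) ^ fg_map inl (word t)] =
    [~ D (gY y), D (gY z) ^ wr_intop P t].
  by move=> Tt; rewrite gmulfR gmulfJ /= !fg_eval_gen g_inl wordP.
apply: (minimal_relator (f := fg_eval g)); last first.
  rewrite /= g_comm // => /eqP/commgP; rewrite -[X in wr_intop P X]invgK.
  by move=> /(two_copies_commuteV c1).
move=> _ [[[u Ru <-]|[v Sv <-]]|[y [z [t [Tt ->]]]]] neq_r /=.
- by rewrite g_inl gXR ?gmulf1.
- by rewrite g_inr gYS ?gmulf1.
rewrite g_comm //; apply/eqP/commgP; apply: two_copies_commute.
- exact: T_neq1.
- by apply/eqP => tE; apply: (T_antisym t0) => //; rewrite -tE.
(* The supports overlap only for t = t0. Then [lam] kills [y] unless y = y0, [mu] kills [z] unless z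
   = z0, and the case left over is [r] itself. *)
move=> /mulg1_eq; rewrite invgK => t0t.
have [yy0|yy0] := eqVneq y y0; last first.
  rewrite lam1; first exact/commute_sym/commute1.
  by apply: sub_normal_closure; exists y => //; apply/eqP.
rewrite mu1; first exact: commute1.
apply: sub_normal_closure; exists z => // zz0.
by case: neq_r; rewrite yy0 zz0 -t0t.
Qed.

End WreathRelations.

Unset Implicit Arguments.

Theorem theorem1 (G H : groupType) (X Y : choiceType)
    (gX : X -> G) (gY : Y -> H)
    (R : set (freegroup X)) (S : set (freegroup Y))
    (T : set G) (word : G -> freegroup X)
    (presG : presentation gX R) (presH : presentation gY S)
    (T_disj : T `&` [set t^-1 | t in T] = set0)
    (T_cover : T `|` [set t^-1 | t in T] = [set~ 1])
    (wordP : forall t, T t -> fg_eval gX (word t) = t) :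
  presentation (wreath_gen gX gY) (wreath_rel R S T word) /\
  (minimal_presentation gX R -> minimal_presentation gY S -> conormal gY ->
   minimal_presentation (wreath_gen gX gY) (wreath_rel R S T word)).
Proof.
have T_neq1 t : T t -> t != 1.
  move=> Tt; have : (T `|` [set t^-1 | t in T]) t by left.
  by rewrite T_cover => /eqP.
have T_antisym t : T t -> ~ T t^-1.
  move=> Tt TtV; have : (T `&` [set t^-1 | t in T]) t.
    by split=> //; exists t^-1; rewrite ?invgK.
  by rewrite T_disj.
have presW := wreath_presentation presG presH T_neq1 wordP T_cover.
split=> // minG minH conY; split=> //.
  by move=> A; apply: wreath_minimal_generators => //; case: minG.
case: minG minH => _ _ minR [_ _ minS].
move=> _ [[[u Ru <-]|[v Sv <-]]|[y [z [t [Tt ->]]]]].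
- exact/wreath_minimal_top_relator/minR.
- by apply: (wreath_minimal_base_relator presG T_neq1 wordP); apply: minS.
- exact: (wreath_minimal_commutator presG presH T_neq1 wordP).
Qed.
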